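(* For all integers $a,b\ge1$, $\phi(p_{a,b})=-(-1)^{a+b}$.
   Context: $p_{a,b}=\sum_{i\in\mathbb{Z}}x_i^ax_{-i}^b$ in commuting variables $x_i$, $i\in\mathbb{Z}$. A signed graph is a finite graph (loops and multiple edges allowed) with $\mathrm{sgn}:E\to\{+,-\}$; a coloring $\kappa:V\to\mathbb{Z}$ is proper if $\kappa(u)\ne\mathrm{sgn}(e)\kappa(v)$ for every edge $e$ with endpoints $u,v$. An orientation assigns to each half-edge (a loop has two) an arrow toward or away from the vertex, such that on a positive edge exactly one of the two arrows points toward its vertex and on a negative edge both point toward or both point away. A cycle is a closed walk in which, considering only the edges of the walk, every vertex of the walk has at least one arrow pointing into it and one pointing out of it; an orientation is acyclic if it has no cycle; a sink is a vertex all of whose incident arrows point toward it (an isolated vertex is a sink). A signed poset is an acyclic orientation $P$ of a signed graph. A proper coloring $\kappa$ preserves $P$ if for every edge $e$ and each endpoint $v$ of $e$, with $u$ the other endpoint ($u=v$ for a loop), the arrow of $P$ at the incidence of $e$ with $v$ points toward $v$ iff $\kappa(v)>\mathrm{sgn}(e)\kappa(u)$. $Y_P=\sum_\kappa\prod_v x_{\kappa(v)}$ over proper colorings preserving $P$; $\mathbb{Y}$ is the $\mathbb{Q}$-span of all $Y_P$ (it is closed under products and contains $p_{a,b}$ for $a\ge1,b\ge0$ and $x_0$). $\phi:\mathbb{Y}\to\mathbb{Q}[t]$ is the (unique) $\mathbb{Q}$-linear map with $\phi(Y_P)=t^{\mathrm{sink}(P)}$, $\mathrm{sink}(P)$ the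 number of sinks of $P$ (its existence is established in the paper). *)

(* Defs.v *)
From Stdlib Require List.
From mathcomp Require Import all_boot all_order all_algebra.
Set Implicit Arguments. Unset Strict Implicit. Unset Printing Implicit Defensive.
Import Order.TTheory GRing.Theory Num.Theory.
Local Open Scope ring_scope.

(* An edge of a signed graph on vertex set 'I_n, together with its orientation.
   Endpoints su, sv (su = sv for a loop); spos = true iff the sign is +;
   sau (resp. sav) = true iff the arrow at the incidence with su (resp. sv)
   points toward su (resp. sv). *)
Record sedge (n : nat) := SEdge {
  su : 'I_n; sv : 'I_n; spos : bool; sau : bool; sav : bool }.

Definition sgnz (b : bool) (x : int) : int := if b then x else - x.

Definition orient_ok n (e : sedge n) : bool := spos e == (sau e != sav e).

Definition toward n (e : sedge n) (w : 'I_n) : bool :=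
  ((su e == w) && sau e) || ((sv e == w) && sav e).
Definition away n (e : sedge n) (w : 'I_n) : bool :=
  ((su e == w) && ~~ sau e) || ((sv e == w) && ~~ sav e).

(* A closed walk given as a nonempty list of pairs (e_i, v_i): edge e_i of E
   joins v_i and v_{i+1} (indices mod the length).  It is a cycle if every
   vertex of the walk has, among the incidences of edges of the walk, one
   arrow pointing into it and one pointing out of it. *)
Definition is_cycle n (E : seq (sedge n)) (w : seq (sedge n * 'I_n)) : Prop :=
  match w with
  | [::] => False
  | d :: _ =>
      (forall p, List.In p w -> List.In p.1 E) /\
      (forall i, (i < size w)%N ->
         let e := (nth d w i).1 in
         let x := (nth d w i).2 in
         let y := (nth d w (i.+1 %% size w)).2 in
         ((su e == x) && (sv e == y)) || ((sv e == x) && (su e == y))) /\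
      (forall p, List.In p w ->
         (exists2 q, List.In q w & toward q.1 p.2) /\
         (exists2 q, List.In q w & away q.1 p.2))
  end.

Definition acyclic n (E : seq (sedge n)) : Prop :=
  forall w, ~ is_cycle E w.

Definition sposet := {n : nat & seq (sedge n)}.

Definition is_sposet (P : sposet) : Prop :=
  all (@orient_ok _) (projT2 P) /\ acyclic (projT2 P).

Definition preserves n (E : seq (sedge n)) (k : 'I_n -> int) : bool :=
  all (fun e =>
    [&& k (su e) != sgnz (spos e) (k (sv e)),
        sau e == (sgnz (spos e) (k (sv e)) < k (su e)) &
        sav e == (sgnz (spos e) (k (su e)) < k (sv e))]) E.

(* coefficient of the monomial prod_{c in s} x_c in Y_P, i.e. the number of
   proper colorings kappa preserving P whose multiset of colors is s *)
Definition coefY n (E : seq (sedge n)) (s : seq int) : nat :=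
  #|[pred f : {ffun 'I_n -> 'I_(size (undup s))} |
      let k := fun v => nth 0 (undup s) (f v) in
      perm_eq [seq k v | v <- enum 'I_n] s && preserves E k]|.

(* coefficient of the monomial prod_{c in s} x_c in p_{a,b}
   = sum_{i in Z} x_i^a x_{-i}^b *)
Definition coefP (a b : nat) (s : seq int) : nat :=
  count (fun i : int => perm_eq s (nseq a i ++ nseq b (- i)))
        (undup (s ++ map (fun c : int => - c) s)).

Definition sinks n (E : seq (sedge n)) : nat :=
  #|[pred v : 'I_n | all (fun e => ((su e == v) ==> sau e) && ((sv e == v) ==> sav e)) E]|.

(* sum_j c_j Y_{P_j} = p_{a,b} as formal power series *)
Definition represents_p (a b : nat) (fam : seq (rat * sposet)) : Prop :=
  (forall x, List.In x fam -> is_sposet x.2) /\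
  (forall s : seq int,
     \sum_(x <- fam) x.1 * (coefY (projT2 x.2) s)%:R = (coefP a b s)%:R).

Definition phi_comb (fam : seq (rat * sposet)) : {poly rat} :=
  \sum_(x <- fam) x.1 *: 'X^(sinks (projT2 x.2)).

(* Main.v *)
From HB Require Import structures.
Require Import Defs.
From mathcomp Require Import all_boot all_order all_algebra.
From mathcomp Require Import zify ring.
Import Order.TTheory GRing.Theory Num.Theory.
Set Implicit Arguments. Unset Strict Implicit. Unset Printing Implicit Defensive.
Local Open Scope ring_scope.

(** Call a coloring packed of level m if its nonzero colors have exactly the
absolute values 1, ..., m.  Weighting each packed coloring of level m preserving
P by (-1)^m gives (-1)^n in total, where n is the number of vertices: removing
the vertices of color m, which are sinks, and of color -m, which are sources,
reduces this to smaller posets, and the inclusion-exclusion sum over the sets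
removed vanishes unless P has no edge, because acyclicity yields a vertex that
is a sink or a source but not both.

If moreover only color m, and not -m, is allowed on top, the set S of vertices
of color m is an arbitrary set of sinks, so weighting by (t - 1)^#S and summing
over S gives t^sink(P).  Thus phi is given by an explicit weighted sum of
coefficients of a power series.  On p_{a,b} only x_0^(a+b), x_1^a x_{-1}^b and
x_{-1}^a x_1^b contribute, the first (-1)^(a+b), the others -(-1)^(a+b) each.

For the expansion of p_{a,b}, multiply out prod_e (1 - [k is proper at e]) over
the edges e of a signed star; all orientations of a star are acyclic. *)

(** * Equality on oriented edges, making list membership boolean *)

Definition sedge_tuple n (e : sedge n) := (su e, sv e, spos e, sau e, sav e).
Definition tuple_sedge n (t : 'I_n * 'I_n * bool * bool * bool) : sedge n :=
  let: (u, v, p, a, b) := t in SEdge u v p a b.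
Lemma sedge_tupleK n : cancel (@sedge_tuple n) (@tuple_sedge n).
Proof. by case. Qed.
HB.instance Definition _ n := Equality.copy (sedge n) (can_type (@sedge_tupleK n)).

Lemma In_mem (T : eqType) (x : T) (s : seq T) : List.In x s <-> x \in s.
Proof.
elim: s => [|y s IH] //=; rewrite inE.
split=> [[->|/IH->]|/predU1P[->|/IH]]; rewrite ?eqxx ?orbT //; by [left|right].
Qed.

(** * Closed walks and the existence of cycles *)

Section Walks.
Variables (n : nat) (E : seq (sedge n)).
Implicit Types (e : sedge n) (x y z : 'I_n) (w : seq (sedge n * 'I_n)).

Definition joins e x y :=
  ((su e == x) && (sv e == y)) || ((sv e == x) && (su e == y)).

Lemma joins_sym e x y : joins e x y = joins e y x.
Proof. by rewrite /joins orbC andbC [X in _ || X]andbC. Qed.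

Fixpoint walk x w y : Prop :=
  if w is (e, v) :: w' then
    [/\ v = x, e \in E & exists2 z, joins e x z & walk z w' y]
  else x = y.

Lemma walk_cat x w1 y w2 z : walk x w1 y -> walk y w2 z -> walk x (w1 ++ w2) z.
Proof.
elim: w1 x => [|[e v] w1 IH] x /=; first by move=> ->.
by case=> -> eE [t j /IH W] /W{}W; split=> //; exists t.
Qed.

Lemma walk_edge e x y : e \in E -> joins e x y -> walk x [:: (e, x)] y.
Proof. by move=> eE j; split=> //; exists y. Qed.

Lemma walk_rev x w y : walk x w y -> exists w', walk y w' x.
Proof.
elim: w x => [|[e v] w IH] x /=; first by move=> ->; exists [::].
case=> _ eE [t j /IH[w' W]]; exists (w' ++ [:: (e, t)]).
by apply: walk_cat W _; apply: walk_edge => //; rewrite joins_sym.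
Qed.

Definition adj x y := has (fun e => joins e x y) E.

Lemma connect_walk x y : connect adj x y -> exists w, walk x w y.
Proof.
case/connectP=> p; elim: p x => [|z p IH] x /=; first by move=> _ ->; exists [::].
case/andP=> /hasP[e eE j] /IH{}IH /IH[w W].
by exists ((e, x) :: w); split=> //; exists z.
Qed.

Lemma walk_prefix x w y p :
  walk x w y -> p \in w -> connect adj x p.2 /\ ((su p.1 == p.2) || (sv p.1 == p.2)).
Proof.
elim: w x => [|[e v] w IH] x //= [-> eE [t j W]].
rewrite inE => /predU1P[->|/(IH _ W)[c ->]] /=.
  by case/orP: j => /andP[-> _]; rewrite ?orbT connect0.
split=> //; apply: connect_trans c; apply: connect1.
by apply/hasP; exists e.
Qed.

Lemma walk_mem x w y p : walk x w y -> p \in w -> p.1 \in E.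
Proof.
elim: w x => [|[e v] w IH] x //= [_ eE [t j W]].
by rewrite inE => /predU1P[->//|/(IH _ W)].
Qed.

Lemma walk_nth d x w y i : walk x w y -> (i < size w)%N ->
  joins (nth d w i).1 (nth d w i).2
        (if (i.+1 < size w)%N then (nth d w i.+1).2 else y).
Proof.
elim: w x i => [|[e v] w IH] x //= i [-> eE [t j W]].
case: i => [_|i] /=; last by rewrite !ltnS; apply: IH W.
by case: w W {IH} => [<-|[e' v'] w] //= [-> _ _].
Qed.

Lemma walk_cycle x w : w != [::] -> walk x w x ->
  (forall p, p \in w -> has (fun q => toward q.1 p.2) w
                     /\ has (fun q => away q.1 p.2) w) ->
  is_cycle E w.
Proof.
case: w => [//|d w] _; set W := d :: w => wk io.
split; first by move=> p /In_mem pW; apply/In_mem; apply: walk_mem wk pW.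
split=> [i ltiw|p /In_mem /io[/hasP[q qW qp] /hasP[r rW rp]]]; last first.
  by split; [exists q|exists r] => //; apply/In_mem.
have:= walk_nth d wk ltiw; rewrite -/W /joins.
case: ifP => [lti|/negbT]; first by rewrite modn_small.
(* At the last index the successor wraps around to position 0, whose vertex is the base point [x] of
   the closed walk. *)
rewrite -leqNgt => lei; have ->: i.+1 = size W by apply/eqP; rewrite eqn_leq lei andbT.
by rewrite modnn /=; case: d @W wk {io ltiw lei} => e v W [->].
Qed.

(* The walk runs back and forth over every edge of the component of x. *)
Lemma walk_cover x : exists2 w, walk x w x &
  forall e, e \in E -> connect adj x (su e) -> (e, su e) \in w.
Proof.
suff cov (F : seq (sedge n)) : {subset F <= E} -> exists2 w, walk x w x &
    forall e, e \in F -> connect adj x (su e) -> (e, su e) \in w by exact: cov.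
elim: F => [|e F IH] sF; first by exists [::].
have [f fF|w W cov] := IH; first by apply: sF; rewrite inE fF orbT.
have eE : e \in E by apply: sF; rewrite inE eqxx.
have [/connect_walk[w1 W1]|no] := boolP (connect adj x (su e)); last first.
  exists w => // f; rewrite inE => /predU1P[->|]; first by rewrite (negbTE no).
  exact: cov.
have [w2 W2] := walk_rev W1.
have je : joins e (su e) (sv e) by rewrite /joins !eqxx.
exists ((w1 ++ (e, su e) :: (e, sv e) :: w2) ++ w); last first.
  move=> f; rewrite inE mem_cat => /predU1P[-> _|fF /(cov _ fF)->].
    by rewrite mem_cat inE eqxx orbT.
  by rewrite orbT.
apply: walk_cat W; apply: walk_cat W1 _; split=> //; exists (sv e) => //.
by split=> //; exists (su e); rewrite // joins_sym.
Qed.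

(** The covering walk from [su e0] uses every edge at each vertex it visits, so the arrows into and
    out of such a vertex that exist in [E] already occur in the walk. *)
Lemma exists_cycle e0 : e0 \in E ->
  (forall e v, e \in E -> (su e == v) || (sv e == v) ->
     has (fun f => toward f v) E /\ has (fun f => away f v) E) ->
  exists w, is_cycle E w.
Proof.
move=> e0E io; have [w W cov] := walk_cover (su e0); exists w.
have covw (f : sedge n) v : f \in E -> connect adj (su e0) v ->
    (su f == v) || (sv f == v) -> exists2 u, (f, u) \in w & true.
  move=> fE c fv; exists (su f) => //; apply: cov => //.
  case/orP: fv => /eqP fv; rewrite ?fv //; apply: connect_trans c _.
  by apply: connect1; apply/hasP; exists f => //; rewrite /joins fv !eqxx orbT.
apply: (walk_cycle _ W).
  by have:= cov _ e0E (connect0 _ _); case: (w).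
move=> p pw; have [cp ep] := walk_prefix W pw.
have [/hasP[f fE fp] /hasP[g gE gp]] := io p.1 p.2 (walk_mem W pw) ep.
split; apply/hasP.
  have [] := covw f p.2 fE cp; last by move=> u fw _; exists (f, u).
  by case/orP: fp => /andP[->]; rewrite ?orbT.
have [] := covw g p.2 gE cp; last by move=> u fw _; exists (g, u).
by case/orP: gp => /andP[->]; rewrite ?orbT.
Qed.
End Walks.

(** * Coefficients as counts of color tuples *)

Definition colors n (k : 'I_n -> int) : seq int := [seq k v | v <- enum 'I_n].

Lemma size_colors n (k : 'I_n -> int) : size (colors k) = n.
Proof. by rewrite size_map size_enum_ord. Qed.

Lemma nth_colors n (k : 'I_n -> int) (v : 'I_n) : nth 0 (colors k) v = k v.
Proof. by rewrite (nth_map v) ?size_enum_ord // nth_ord_enum. Qed.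

Lemma colors_nth n (t : seq int) :
  size t = n -> colors (fun v : 'I_n => nth 0 t v) = t.
Proof.
move=> st; apply: (@eq_from_nth _ 0) => [|i]; rewrite size_colors ?st // => lti.
by rewrite (nth_colors _ (Ordinal lti)).
Qed.

Lemma mem_colors n (k : 'I_n -> int) v : k v \in colors k.
Proof. by rewrite map_f // mem_enum. Qed.

Lemma colorsP n (k : 'I_n -> int) c :
  reflect (exists v, k v = c) (c \in colors k).
Proof.
by apply: (iffP mapP) => [[v _ ->]|[v <-]]; exists v; rewrite ?mem_enum.
Qed.

Lemma eq_preserves n (E : seq (sedge n)) (k k' : 'I_n -> int) :
  k =1 k' -> preserves E k = preserves E k'.
Proof. by move=> ek; apply: eq_all => e; rewrite !ek. Qed.

(** Since [undup s] has no repetition, an index-valued map and its tuple of colors determine each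
    other. *)
Lemma coefYE n (E : seq (sedge n)) (s : seq int) :
  coefY E s = count (fun t => (size t == n) && preserves E (fun v => nth 0 t v))
                    (permutations s).
Proof.
rewrite /coefY; set A := [pred f | _]; rewrite cardE -size_filter.
pose k (f : {ffun 'I_n -> 'I_(size (undup s))}) v := nth 0 (undup s) (f v).
rewrite -(size_map (fun f => colors (k f)) (enum A)); apply: perm_size.
apply: uniq_perm; last 1 first.
- move=> t; rewrite mem_filter mem_permutations; apply/mapP/idP.
    case=> f; rewrite mem_enum inE => /andP[fs pr] ->.
    rewrite size_colors eqxx -/(colors _) fs andbT /=.
    by rewrite (@eq_preserves _ _ _ (k f)) // => v; rewrite nth_colors.
  case/andP=> /andP[/eqP st pr] ts.
  have lt_t (v : 'I_n) : (index (nth 0%R t v) (undup s) < size (undup s))%N.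
    by rewrite index_mem mem_undup -(perm_mem ts) mem_nth ?st.
  have kt : k [ffun v => Ordinal (lt_t v)] =1 fun v => nth 0 t v.
    by move=> v; rewrite /k ffunE /= nth_index // -index_mem.
  have ct : colors (k [ffun v => Ordinal (lt_t v)]) = t.
    by rewrite -[RHS](colors_nth st); apply: eq_map.
  exists [ffun v => Ordinal (lt_t v)] => //.
  rewrite mem_enum inE -/(colors _) -/(k _) ct ts /=.
  by rewrite (eq_preserves _ kt).
- rewrite map_inj_uniq ?enum_uniq // => f g efg; apply/ffunP=> v.
  have := nth_colors (k f) v; rewrite efg nth_colors => /eqP.
  by rewrite nth_uniq ?undup_uniq // => /eqP /val_inj.
- by rewrite filter_uniq ?permutations_uniq.
Qed.

(** Selects one arrangement of each monomial of p_{a,b}. Reading i off the head keeps the predicate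
    boolean. *)
Definition balanced a b (t : seq int) :=
  t == nseq a (head 0 t) ++ nseq b (- head 0 t).

Lemma head_nseq_cat a b (i : int) :
  (0 < a)%N -> head 0 (nseq a i ++ nseq b (- i)) = i.
Proof. by case: a. Qed.

Lemma coefPE a b (s : seq int) : (0 < a)%N ->
  coefP a b s = count (balanced a b) (permutations s).
Proof.
move=> a_gt0; rewrite /coefP -!size_filter.
rewrite -(size_map (fun i : int => nseq a i ++ nseq b (- i))); apply: perm_size.
apply: uniq_perm.
- rewrite map_inj_uniq ?filter_uniq ?undup_uniq //.
  by move=> i j /(congr1 (head 0)); rewrite !head_nseq_cat.
- by rewrite filter_uniq ?permutations_uniq.
move=> t; rewrite mem_filter mem_permutations; apply/mapP/andP.
  case=> i; rewrite mem_filter perm_sym => /andP[si _] ->.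
  by rewrite /balanced head_nseq_cat.
case=> /eqP bt ts; exists (head 0 t) => //.
rewrite mem_filter -bt perm_sym ts mem_undup mem_cat -(perm_mem ts).
suff ->: head 0 t \in t by [].
by rewrite {2}bt mem_cat mem_nseq a_gt0 eqxx.
Qed.

Lemma natr_count (R : pzSemiRingType) (T : Type) (G : pred T) (s : seq T) :
  (count G s)%:R = \sum_(t <- s) (G t)%:R :> R.
Proof. by elim: s => [|t s IH]; rewrite ?big_nil ?big_cons //= natrD IH. Qed.

(* A multiset of colors is represented by its sorted enumeration, so that the
   permutations of the representatives run over each tuple exactly once. *)
Lemma sum_permutations (R : pzSemiRingType) (L : seq (seq int))
    (w : seq int -> R) (G : pred (seq int)) :
  uniq L -> (forall s t, perm_eq s t -> s \in L -> t \in L) ->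
  (forall s t, perm_eq s t -> w s = w t) ->
  \sum_(s <- undup [seq sort <=%R t | t <- L])
     w s * (count G (permutations s))%:R = \sum_(t <- L) w t * (G t)%:R.
Proof.
move=> uL pL pw; set C := undup _.
have memC s : s \in C -> s \in L /\ sort <=%R s = s.
  rewrite mem_undup => /mapP[t tL ->]; split.
    by apply: pL tL; rewrite perm_sym perm_sort.
  by apply: sorted_sort; [exact: le_trans | apply: sort_sorted; exact: le_total].
transitivity (\sum_(t <- [seq t | s <- C, t <- permutations s]) w t * (G t)%:R).
  rewrite big_allpairs_dep /=; apply: eq_bigr => s _.
  rewrite natr_count mulr_sumr big_seq [RHS]big_seq.
  by apply: eq_bigr => t; rewrite mem_permutations => /pw->.
apply: perm_big; apply: uniq_perm => //.
  apply: allpairs_uniq_dep; first exact: undup_uniq.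
    by move=> s _; exact: permutations_uniq.
  move=> p q /allpairsPdep[s [t [/memC[_ ss] st ->]]].
  move=> /allpairsPdep[s' [t' [/memC[_ ss'] st' ->]]] /= tt'; subst t'.
  have: perm_eq s s'.
    by move: st st'; rewrite !mem_permutations perm_sym => /perm_trans; apply.
  by move/(perm_sort_leP _ _); rewrite ss ss' => ->.
move=> t; apply/allpairsPdep/idP.
  case=> s [t' [/memC[sL _]]]; rewrite mem_permutations perm_sym => st ->.
  exact: pL st sL.
move=> tL; exists (sort <=%R t), t; split=> //.
  by rewrite mem_undup; apply/mapP; exists t.
by rewrite mem_permutations perm_sym perm_sort.
Qed.

(** * Packed colorings, built one absolute value at a time *)

Lemma natr_forall (R : comPzRingType) (T : finType) (b : pred T) :
  ([forall v, b v])%:R = \prod_v (b v)%:R :> R.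
Proof.
have [/forallP bT|/forallPn[v bv]] := boolP [forall v, b v].
  by rewrite big1 // => v _; rewrite bT.
by rewrite (bigD1 v) //= (negbTE bv) mul0r.
Qed.

Section Layers.
Variable n : nat.
Implicit Types (U : {set 'I_n}) (k : {ffun 'I_n -> int}).
Implicit Types (top : {ffun 'I_n -> option bool}).

(* A top layer sends its vertices to the largest color m ([Some true]) or to
   -m ([Some false]); the other vertices ([None]) get colors of smaller
   absolute value. *)
Definition supp top : {set 'I_n} := [set v | top v != None].

Definition place (m : nat) top k : {ffun 'I_n -> int} :=
  [ffun v => if top v is Some c then sgnz c m%:Z else k v].

Definition proper_top U top := (supp top \subset U) && (supp top != set0).

(** Vertices outside [U] carry the dummy color 0, so colorings of a subset still live on all of
    ['I_n]. The nonempty support required at each step forces every absolute value from 1 to [m] to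
    occur. *)
Fixpoint layers (m : nat) U : seq {ffun 'I_n -> int} :=
  if m is m'.+1 then
    [seq place m top k |
       top <- [seq top <- enum {: {ffun 'I_n -> option bool}} | proper_top U top],
       k <- layers m' (U :\: supp top)]
  else [:: [ffun=> 0]].

Lemma big_layersS (R : nmodType) m U (F : {ffun 'I_n -> int} -> R) :
  \sum_(k <- layers m.+1 U) F k =
  \sum_(top | proper_top U top)
    \sum_(k <- layers m (U :\: supp top)) F (place m.+1 top k).
Proof. by rewrite big_allpairs_dep big_filter big_enum_cond. Qed.

Definition layered (m : nat) U k :=
  [/\ forall v, v \notin U -> k v = 0,
      forall v, (absz (k v) <= m)%N &
      forall c, (0 < c <= m)%N -> exists v, absz (k v) = c].

Lemma layers_layered m U k : k \in layers m U -> layered m U k.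
Proof.
elim: m U k => [|m IH] U k /=.
  rewrite inE => /eqP->; split=> [v _|v|c]; rewrite ?ffunE //.
  by case/andP; case: c.
case/allpairsPdep=> top [k' []]; rewrite mem_filter mem_enum andbT.
case/andP=> /subsetP sU /set0Pn[v0]; rewrite inE => v0top.
case/IH=> k0 kle kall ->.
split=> [v vU|v|c].
- rewrite ffunE; have: v \notin supp top by apply: contra vU => /sU.
  rewrite inE negbK => /eqP->; apply: k0.
  by rewrite inE negb_and vU orbT.
- by rewrite ffunE; have:= kle v; case: (top v) => [[]|] /=; lia.
move=> /andP[c_gt0]; rewrite leq_eqVlt => /predU1P[->|]; last rewrite ltnS => lecm.
  by exists v0; rewrite ffunE; case: (top v0) v0top => [[]|].
have [v kv] : exists v, absz (k' v) = c by apply: kall; rewrite c_gt0.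
exists v; rewrite ffunE; case topv: (top v) => [b|//].
have: v \notin U :\: supp top by rewrite !inE topv.
by move/k0 => kv0; rewrite kv0 in kv; rewrite -kv in c_gt0.
Qed.

Lemma mem_layers m U k : k \in layers m U <-> layered m U k.
Proof.
split; first exact: layers_layered.
elim: m U k => [|m IH] U k [k0 kle kall] /=.
  rewrite inE; apply/eqP/ffunP=> v; rewrite ffunE.
  by apply/eqP; rewrite -absz_eq0 -leqn0.
(* The top layer is forced by the vertices of color m+1 or -(m+1); resetting those to 0 leaves a
   coloring of level m. *)
pose top : {ffun 'I_n -> option bool} :=
  [ffun v => if k v == m.+1%:Z then Some true
             else if k v == - m.+1%:Z then Some false else None].
apply/allpairsPdep; exists top, [ffun v => if top v is Some _ then 0 else k v].
split; last first.
- by apply/ffunP=> v; rewrite !ffunE; do 2?case: eqP => //.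
- apply: IH; split=> [v|v|c].
  + rewrite !inE !ffunE negb_and; case: ifP => // _; case: ifP => //= _.
    exact: k0.
  + by rewrite !ffunE; have:= kle v; do 2?case: eqP => //; lia.
  case/andP=> c_gt0 lecm.
  have [|v kv] := kall c; first by rewrite c_gt0 leqW.
  by exists v; rewrite !ffunE; do 2?case: eqP => //; lia.
rewrite mem_filter mem_enum andbT; apply/andP; split.
  apply/subsetP=> v; rewrite inE ffunE; apply: contraNT => /k0->.
  by do 2?case: eqP => //; lia.
have [|v kv] := kall m.+1; first by rewrite /= leqnn.
apply/set0Pn; exists v; rewrite inE ffunE.
by case: (k v =P m.+1%:Z) => // h1; case: (k v =P - m.+1%:Z) => // h2; lia.
Qed.

(** Lower colors have absolute value at most m, so the top layer can be recovered from the placed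
    coloring; on its support the lower coloring is 0. *)
Lemma layers_uniq m U : uniq (layers m U).
Proof.
elim: m U => [|m IH] U //=; apply: allpairs_uniq_dep => //.
  by rewrite filter_uniq ?enum_uniq.
move=> p q /allpairsPdep[t [k [_ kL ->]]] /allpairsPdep[t' [k' [_ kL' ->]]] /=.
move/ffunP=> e; move: kL kL' => /layers_layered[k0 kle _] /layers_layered[k0' kle' _].
have tt' : t = t'.
  apply/ffunP=> v; have:= e v; rewrite !ffunE; have:= kle v; have:= kle' v.
  by case: (t v) => [[]|]; case: (t' v) => [[]|] //=; lia.
subst t'; congr (Tagged _ _); apply/ffunP=> v; have:= e v; rewrite !ffunE.
case tv: (t v) => [b|] // _.
by rewrite k0 ?k0' // !inE tv.
Qed.

(** The sum factors over vertices: each vertex of [U] independently stays out of the top layer,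
    contributing 1, or picks a sign [c]. *)
Lemma sum_subset_tops (R : comPzRingType) U (P : 'I_n -> bool -> bool) (y : bool -> R) :
  \sum_(top : {ffun 'I_n -> option bool} | supp top \subset U)
     ([forall v, if top v is Some c then P v c else true])%:R
     * \prod_v (if top v is Some c then y c else 1)
  = \prod_(v in U) (1 + \sum_(c : bool) (P v c)%:R * y c).
Proof.
pose F v o := if o is Some c then ((v \in U) && P v c)%:R * y c else 1 : R.
have ->: \prod_(v in U) (1 + \sum_(c : bool) (P v c)%:R * y c)
    = \prod_v \sum_(o : option bool) F v o.
  rewrite big_mkcond /=; apply: eq_bigr => v _.
  rewrite (bigD1 None) //= (reindex_omap Some id) /=; last by case.
  rewrite /F; case: (v \in U) => /=.
    by congr (_ + _); apply: eq_bigl => c; rewrite eqxx.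
  by rewrite big1 ?addr0 // => c _; rewrite mul0r.
rewrite bigA_distr_bigA [RHS](bigID (fun top => supp top \subset U)) /=.
rewrite [X in _ = _ + X]big1 ?addr0 => [|top /subsetPn[v]]; last first.
  rewrite inE => tv vU; rewrite (bigD1 v) //= /F.
  by case: (top v) tv => // c _; rewrite (negbTE vU) !mul0r.
apply: eq_bigr => top /subsetP sU.
rewrite natr_forall -big_split /=; apply: eq_bigr => v _; rewrite /F.
case tv: (top v) => [c|]; last by rewrite mulr1.
by rewrite sU // inE tv.
Qed.

Lemma sum_tops (R : comPzRingType) U (P : 'I_n -> bool -> bool) (y : bool -> R) :
  \sum_(top : {ffun 'I_n -> option bool} | proper_top U top)
     ([forall v, if top v is Some c then P v c else true])%:R
     * \prod_v (if top v is Some c then y c else 1)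
  = \prod_(v in U) (1 + \sum_(c : bool) (P v c)%:R * y c) - 1.
Proof.
have s0 : supp [ffun=> None] = set0 by apply/setP=> v; rewrite !inE ffunE.
rewrite -sum_subset_tops [X in _ = X - 1](bigD1 [ffun=> None]) /= ?s0 ?sub0set //.
rewrite [\prod_v _]big1 => [|v _]; last by rewrite ffunE.
rewrite (_ : [forall v, _] = true); last by apply/forallP=> v; rewrite ffunE.
rewrite mulr1 addrAC subrr add0r; apply: eq_bigl => top.
rewrite /proper_top; congr (_ && ~~ _); apply/eqP/eqP=> [st|->//].
apply/ffunP=> v; rewrite ffunE; apply/eqP.
by have /setP/(_ v) := st; rewrite !inE => /negbFE.
Qed.

End Layers.

(** * Removal of the top layer and the alternating count *)

Section Restrict.
Variable n : nat.
Implicit Types (E : seq (sedge n)) (U : {set 'I_n}) (k : {ffun 'I_n -> int}).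
Implicit Types (top : {ffun 'I_n -> option bool}).

Definition restrict E U := [seq e <- E | (su e \in U) && (sv e \in U)].

(* Sinks for c = true, sources for c = false. *)
Definition extremal E v c :=
  all (fun e => ((su e == v) ==> (sau e == c)) && ((sv e == v) ==> (sav e == c))) E.

Lemma sinksE E : sinks E = #|[pred v | extremal E v true]|.
Proof.
apply: eq_card => v; rewrite !inE; apply: eq_all => e.
by rewrite !eqb_id.
Qed.

Definition fits (e : sedge n) (k : 'I_n -> int) :=
  [&& k (su e) != sgnz (spos e) (k (sv e)),
      sau e == (sgnz (spos e) (k (sv e)) < k (su e)) &
      sav e == (sgnz (spos e) (k (su e)) < k (sv e))].

Definition fits_top (o : option bool) (b : bool) :=
  if o is Some c then b == c else true.

(** Color m+1 exceeds, and -(m+1) lies below, every smaller color with either sign, so a top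
    endpoint dictates its own arrow. If both endpoints are on top, the coloring is improper exactly
    when the dictated arrows violate [orient_ok]. *)
Lemma fits_place e m top k : orient_ok e -> (forall v, (absz (k v) <= m)%N) ->
  fits e (place m.+1 top k) =
  [&& fits_top (top (su e)) (sau e), fits_top (top (sv e)) (sav e) &
      (su e \notin supp top) && (sv e \notin supp top) ==> fits e k].
Proof.
rewrite /orient_ok /fits !ffunE !inE => /eqP-> kle.
have := kle (su e); have := kle (sv e).
case: (sau e); case: (sav e); case: (top (su e)) => [[]|];
  case: (top (sv e)) => [[]|] //=; rewrite /sgnz /=; lia.
Qed.

Lemma all_fits_top E top :
  all (fun e => fits_top (top (su e)) (sau e) && fits_top (top (sv e)) (sav e)) E
  = [forall v, if top v is Some c then extremal E v c else true].
Proof.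
apply/allP/forallP => [ok v|ok e eE].
  case tv: (top v) => [c|] //; apply/allP=> e /ok /andP[].
  by move=> h1 h2; apply/andP; split; apply/implyP=> /eqP ev;
     move: h1 h2; rewrite ev tv.
apply/andP; split; [have:= ok (su e)|have:= ok (sv e)].
  by case: (top _) => [c|] // /allP/(_ e eE)/andP[]; rewrite eqxx.
by case: (top _) => [c|] // /allP/(_ e eE)/andP[_]; rewrite eqxx.
Qed.

(** Edges meeting the top layer constrain only [top], up to the other ends having smaller absolute
    value; the remaining edges constrain only [k]. *)
Lemma preserves_place E U m top k :
    all (@orient_ok n) E -> supp top \subset U ->
    k \in layers m (U :\: supp top) ->
  preserves (restrict E U) (place m.+1 top k) =
  [forall v, if top v is Some c then extremal (restrict E U) v c else true]
  && preserves (restrict E (U :\: supp top)) k.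
Proof.
move=> /allP ok sU /layers_layered[_ kle _]; rewrite -all_fits_top.
have ->: restrict E (U :\: supp top) =
    [seq e <- restrict E U | (su e \notin supp top) && (sv e \notin supp top)].
  rewrite /restrict -filter_predI; apply: eq_filter => e /=.
  by rewrite !inE andbACA.
rewrite /preserves all_filter -all_predI; apply: eq_in_all => e /=.
rewrite mem_filter => /andP[_ /ok oe].
by rewrite -/(fits e _) -/(fits e _) fits_place // -andbA.
Qed.

Lemma preserves0 E : preserves E [ffun=> 0] = nilp E.
Proof.
by case: E => [|e E] //=; rewrite !ffunE /sgnz oppr0 if_same eqxx.
Qed.

Lemma acyclic_restrict E U : acyclic E -> acyclic (restrict E U).
Proof.
move=> acE [|d w] //= [sE c]; apply: (acE (d :: w)); split=> // p /sE.
by move/In_mem; rewrite mem_filter => /andP[_ /In_mem].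
Qed.

(** An endpoint of an edge cannot be both sink and source. If every endpoint were neither, each
    would have arrows in and out, and [exists_cycle] would apply. *)
Lemma acyclic_extremal E : acyclic E -> ~~ nilp E ->
  exists2 e, e \in E &
    exists2 v, (v == su e) || (v == sv e) & extremal E v true != extremal E v false.
Proof.
move=> acE nE; suff /hasP[e eE H]: has (fun e =>
    (extremal E (su e) true != extremal E (su e) false)
    || (extremal E (sv e) true != extremal E (sv e) false)) E.
  by exists e => //; case/orP: H => H; [exists (su e)|exists (sv e)];
     rewrite ?eqxx ?orbT.
apply/negPn/negP; rewrite -all_predC => /allP same.
have [e0 e0E] : exists e0, e0 \in E.
  by case: (E) nE => // e0 E' _; exists e0; rewrite inE eqxx.
have [//||w /acE//] := @exists_cycle n E e0.
move=> e v eE ev.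
have : extremal E v true = extremal E v false.
  have := same e eE; rewrite /= negb_or !negbK => /andP[/eqP eu /eqP ew].
  by case/orP: ev => /eqP <-.
have xp c : extremal E v (~~ c) = false -> has (fun e =>
    (su e == v) && (sau e == c) || (sv e == v) && (sav e == c)) E.
  move/negbT; rewrite -has_predC; apply: sub_has => f /=.
  by rewrite negb_and !negb_imply; case: (sau f) (sav f) c => [] [] [].
have: ~~ (extremal E v true && extremal E v false).
  apply/negP=> /andP[/allP/(_ e eE)/andP[t1 t2] /allP/(_ e eE)/andP[f1 f2]].
  by case/orP: ev => ev; move: t1 t2 f1 f2; rewrite ev /=; case: (sau e) (sav e) => [] [].
case ext: (extremal E v true); case exf: (extremal E v false) => // _ _.
split.
  have:= xp true exf; apply: sub_has => f /=; rewrite /toward.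
  by case: (sau f) (sav f) => [] [].
have:= xp false ext; apply: sub_has => f /=; rewrite /away.
by case: (sau f) (sav f) => [] [].
Qed.

Variable R : comPzRingType.

(* The number of colorings with colors in [-m, m] is a polynomial in m, and
   this alternating sum is its value at m = -1. *)
Definition euler E U M : R :=
  \sum_(m < M) (-1) ^+ m * \sum_(k <- layers m U) (preserves (restrict E U) k)%:R.

Lemma sum_layersS E U m top : all (@orient_ok n) E -> supp top \subset U ->
  \sum_(k <- layers m (U :\: supp top))
     (preserves (restrict E U) (place m.+1 top k))%:R =
  ([forall v, if top v is Some c then extremal (restrict E U) v c else true])%:R *
  \sum_(k <- layers m (U :\: supp top))
     (preserves (restrict E (U :\: supp top)) k)%:R :> R.
Proof.
move=> ok sU; rewrite mulr_sumr big_seq [RHS]big_seq.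
by apply: eq_bigr => k kL; rewrite preserves_place // -mulnb natrM.
Qed.

(** Level 0 consists of the zero coloring, improper at any edge; in the other levels, peeling off
    the top layer lowers the level by one and flips the sign. *)
Lemma eulerS E U M : all (@orient_ok n) E ->
  euler E U M.+1 = (nilp (restrict E U))%:R -
  \sum_(top : {ffun 'I_n -> option bool} | proper_top U top)
   ([forall v, if top v is Some c then extremal (restrict E U) v c else true])%:R *
   euler E (U :\: supp top) M.
Proof.
move=> ok; rewrite /euler big_ord_recl /= expr0 mul1r big_seq1 preserves0.
congr (_ + _); rewrite -sumrN.
under [RHS]eq_bigr do rewrite mulr_sumr -sumrN.
rewrite [RHS]exchange_big /=; apply: eq_bigr => m _.
rewrite big_layersS mulr_sumr; apply: eq_bigr => top /andP[sU _].
by rewrite sum_layersS // exprS mulN1r mulNr mulrCA.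
Qed.

Lemma prod_supp top (y : R) :
  \prod_v (if top v is Some _ then y else 1) = y ^+ #|supp top|.
Proof.
rewrite -prodr_const [RHS]big_mkcond; apply: eq_bigr => v _.
by rewrite inE; case: (top v).
Qed.

(** Levels above [#|U|] are empty, so the truncation at [M] is harmless. By induction each top layer
    contributes [(-1) ^+ #|U|] times -1 per top vertex, and [sum_tops] turns the sum into a product
    over [U]. *)
Lemma eulerE E U M : all (@orient_ok n) E -> acyclic E -> (#|U| < M)%N ->
  euler E U M = (-1) ^+ #|U|.
Proof.
move=> ok acE; elim: M U => // M IH U; rewrite ltnS => leUM; rewrite eulerS //.
pose y (c : bool) : R := -1.
have termE top : proper_top U top ->
  ([forall v, if top v is Some c then extremal (restrict E U) v c else true])%:R *
   euler E (U :\: supp top) M = (-1) ^+ #|U| *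
  (([forall v, if top v is Some c then extremal (restrict E U) v c else true])%:R *
   \prod_v (if top v is Some c then y c else 1)).
  case/andP=> sU; rewrite -card_gt0 => s_gt0.
  have cU := cardsD U (supp top); have le_s := subset_leq_card sU.
  rewrite (setIidPr sU) in cU.
  rewrite IH ?prod_supp; last by lia.
  by rewrite cU -signr_odd oddB // signr_addb !signr_odd mulrCA.
rewrite (eq_bigr _ termE) -mulr_sumr sum_tops.
(* Without edges every vertex is both sink and source, and each factor is 1 - 1 - 1 = -1. With an
   edge, a vertex with exactly one of the two properties gives a factor 0. *)
have [Enil|Enil] := boolP (nilp (restrict E U)).
  rewrite (eq_bigr (fun=> -1)) => [|v vU].
    by rewrite prodr_const mulrBr mulr1 -expr2 sqrr_sign opprB addrC subrK.
  by rewrite (nilP Enil) /y big_bool !mul1r addrA subrr sub0r.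
have [e eE [v ev vx]] := acyclic_extremal (acyclic_restrict acE) Enil.
have vU : v \in U.
  by move: eE; rewrite mem_filter => /andP[/andP[? ?] _]; case/orP: ev => /eqP->.
rewrite (bigD1 v) //= big_bool /y.
rewrite [1 + _](_ : _ = 0) ?mul0r ?sub0r ?mulrN1 ?opprK //.
case: (extremal _ v true) vx; case: (extremal _ v false) => //= _;
  by rewrite ?mulr1n !mulr0n ?oppr0 ?addr0 ?add0r subrr.
Qed.

End Restrict.

(** * Packed colorings as tuples and multisets *)

Section Packed.
Variables (n m : nat).

Definition packed : seq (seq int) := [seq colors k | k : {ffun 'I_n -> int} <- layers m [set: 'I_n]].

Lemma packed_uniq : uniq packed.
Proof.
rewrite map_inj_uniq ?layers_uniq // => k k' ekk'.
by apply/ffunP=> v; rewrite -!nth_colors ekk'.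
Qed.

(** The right-hand side involves only size and membership, whence invariance under permutation. *)
Lemma mem_packed t : t \in packed <->
  [/\ size t = n, forall c, c \in t -> (absz c <= m)%N
    & forall c, (0 < c <= m)%N -> exists2 z, z \in t & absz z = c].
Proof.
split=> [/mapP[k /mem_layers[_ kle kall] ->]|[st tle tall]].
  rewrite size_colors; split=> // [c /colorsP[v <-] //|c /kall[v <-]].
  by exists (k v); rewrite ?mem_colors.
pose k : {ffun 'I_n -> int} := [ffun v : 'I_n => nth 0 t v].
have ct : colors k = t.
  by rewrite -[RHS](colors_nth st); apply: eq_map => v; rewrite ffunE.
apply/mapP; exists k; last by [].
apply/mem_layers; split=> [v|v|c /tall[z]]; first by rewrite inE.
  by apply: tle; rewrite -ct mem_colors.
by rewrite -ct => /colorsP[v <-] <-; exists v.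
Qed.

Lemma packed_perm s t : perm_eq s t -> s \in packed -> t \in packed.
Proof.
move=> st /mem_packed[ss sle sall]; apply/mem_packed.
split; first by rewrite -(perm_size st).
  by move=> c; rewrite -(perm_mem st); apply: sle.
by move=> c /sall[z zs <-]; exists z; rewrite -?(perm_mem st).
Qed.

Definition packed_multisets := undup [seq sort <=%R t | t <- packed].

End Packed.

(** * The weighted count of colorings yields the sink polynomial *)

Section Weight.
Variables (R : comPzRingType) (x : R).

(* The two summands pick out the subsets S of sinks, each with weight
   (x - 1)^#|S|: the first one is S = set0, and in the second S is the set of
   vertices of color m. *)
Definition weight (m : nat) (t : seq int) : R :=
  (-1) ^+ (size t + m) *
  (1 - ((0 < m)%N && (- m%:Z \notin t))%:R * (1 - x) ^+ count_mem m%:Z t).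

Lemma weight_perm m s t : perm_eq s t -> weight m s = weight m t.
Proof.
move=> st; rewrite /weight (perm_size st) (perm_mem st).
by move/permP: st => ->.
Qed.

(** Puts the weight in the product form required by [sum_tops]: the factor 0 at color -(m+1) encodes
    the indicator in [weight]. *)
Lemma weight_place n m (top : {ffun 'I_n -> option bool}) k :
  k \in layers m (~: supp top) ->
  weight m.+1 (colors (place m.+1 top k)) = - (-1) ^+ (n + m) *
   (1 - \prod_v (if top v is Some c then (if c then 1 - x else 0) else 1)).
Proof.
case/layers_layered=> _ kle _; rewrite /weight size_colors /=.
rewrite addnS exprS mulN1r; congr (_ * (1 - _)).
pose h (c : int) := if c == m.+1%:Z then 1 - x else if c == - m.+1%:Z then 0 else 1.
have hE t : (- m.+1%:Z \notin t)%:R * (1 - x) ^+ count_mem m.+1%:Z t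
    = \prod_(c <- t) h c.
  elim: t => [|c t IH]; first by rewrite big_nil mul1r.
  rewrite big_cons -IH inE negb_or /= /h [_ == c]eq_sym.
  case: (c =P m.+1%:Z) => [->|_] /=; first by rewrite exprS mulrCA.
  by case: (c =P _) => _ /=; rewrite ?mul0r ?mul1r.
rewrite hE big_map big_enum; apply: eq_bigr => v _.
rewrite /h ffunE; have:= kle v.
case: (top v) => [[]|] /=; rewrite ?eqxx //.
by do 2?[case: eqP => /=]; rewrite // => *; lia.
Qed.

Lemma restrictT n (E : seq (sedge n)) : restrict E [set: 'I_n] = E.
Proof. by apply/all_filterP/allP=> e _; rewrite !inE. Qed.

Lemma sum_weight_preserves n (E : seq (sedge n)) :
    all (@orient_ok n) E -> acyclic E ->
  \sum_(m < n.+1) \sum_(k <- layers m [set: 'I_n])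
    weight m (colors k) * (preserves E k)%:R = x ^+ sinks E.
Proof.
move=> ok acE.
pose y (c : bool) : R := if c then x - 1 else 0.
pose pr (top : {ffun 'I_n -> option bool}) : R :=
  \prod_v (if top v is Some c then (if c then 1 - x else 0) else 1).
pose okt (top : {ffun 'I_n -> option bool}) :=
  [forall v, if top v is Some c then extremal E v c else true].
pose D m := \sum_(k <- layers m [set: 'I_n])
  (weight m (colors k) - (-1) ^+ (n + m)) * (preserves E k)%:R.
(* The pure sign part of the weight gives the Euler sum, worth 1 after multiplication by
   [(-1) ^+ n]; [D] collects the part depending on [x]. *)
transitivity ((-1) ^+ n * euler R E [set: 'I_n] n.+1 + \sum_(m < n.+1) D m).
  rewrite mulr_sumr -big_split; apply: eq_bigr => m _ /=.
  rewrite mulrA -exprD restrictT mulr_sumr -big_split; apply: eq_bigr => k _ /=.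
  by rewrite mulrBl addrC subrK.
rewrite eulerE ?cardsT ?card_ord // -expr2 sqrr_sign big_ord_recl.
have -> : D 0 = 0.
  by rewrite /D big_seq1 /weight size_colors /= mul0r subr0 mulr1 subrr mul0r.
have DS (m : 'I_n) : D m.+1 = \sum_(top | proper_top [set: 'I_n] top)
    (-1) ^+ n * pr top * (okt top)%:R * ((-1) ^+ m *
      \sum_(k <- layers m (~: supp top)) (preserves (restrict E (~: supp top)) k)%:R).
  rewrite /D big_layersS; apply: eq_bigr => top /andP[sU _].
  have := sum_layersS R m ok sU; rewrite setTD restrictT => ss.
  rewrite [RHS]mulrCA -(mulrA (_ * pr top)) -ss.
  rewrite mulrA mulr_sumr big_seq [RHS]big_seq; apply: eq_bigr => k kL.
  rewrite weight_place // -/(pr top) addnS exprS exprD; ring.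
rewrite add0r (eq_bigr _ (fun m _ => DS m)) exchange_big /=.
have -> : x ^+ sinks E = \prod_(v in [set: 'I_n]) (1 + \sum_(c : bool) (extremal E v c)%:R * y c).
  rewrite sinksE -prodr_const big_mkcond [RHS]big_mkcond; apply: eq_bigr => v _.
  rewrite !inE big_bool /y /= mulr0.
  by case: (extremal E v true) => /=; ring.
rewrite -[RHS](subrK 1) [RHS]addrC -sum_tops; congr (_ + _).
apply: eq_bigr => top /andP[_ s0]; rewrite -mulr_sumr -/(euler R E (~: supp top) n).
(* A nonempty top layer leaves fewer than n vertices, so n levels suffice for [eulerE]. *)
have lt_s : (#|~: supp top| < n)%N.
  by rewrite cardsCs setCK card_ord; move: s0 (max_card (supp top)); rewrite -card_gt0 card_ord; lia.
rewrite eulerE //.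
(* The sign of the complement supplies -1 per top vertex, turning 1 - x into x - 1. *)
have sign : (-1) ^+ #|~: supp top| = (-1) ^+ n * \prod_v (if top v is Some _ then -1 else 1) :> R.
  rewrite prod_supp cardsCs setCK card_ord -signr_odd oddB ?signr_addb ?signr_odd //.
  by rewrite -[X in (_ <= X)%N]card_ord max_card.
have -> : \prod_v (if top v is Some c then y c else 1)
    = pr top * \prod_v (if top v is Some _ then -1 else 1).
  rewrite -big_split; apply: eq_bigr => v _ /=; rewrite /y.
  by case: (top v) => [[]|] /=; ring.
rewrite sign -/(okt top); move: (\prod_v _) => q.
transitivity ((-1) ^+ n ^+ 2 * ((okt top)%:R * (pr top * q))); first by ring.
by rewrite sqrr_sign mul1r.
Qed.
End Weight.

(** * A functional on coefficients that computes phi *)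

Section Functional.

(** Reads only coefficients of degree below [N]; levels up to n suffice, since an n-tuple has at
    most n absolute values. *)
Definition functional (N : nat) (F : seq int -> rat) : {poly rat} :=
  \sum_(n < N) \sum_(m < n.+1) \sum_(s <- packed_multisets n m)
    weight 'X m s * (F s)%:P.

Lemma functional_count N (F : seq int -> rat) (G : pred (seq int)) n0 :
    (n0 < N)%N -> (forall t, G t -> size t = n0) ->
    (forall s, F s = (count G (permutations s))%:R) ->
  functional N F = \sum_(m < n0.+1) \sum_(k <- layers m [set: 'I_n0])
    weight 'X m (colors k) * (G (colors k))%:R.
Proof.
move=> lt0N sG FG.
have rowE n m : \sum_(s <- packed_multisets n m) weight 'X m s * (F s)%:P
    = \sum_(k <- layers m [set: 'I_n]) weight 'X m (colors k) * (G (colors k))%:R :> {poly rat}.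
  rewrite -(big_map (fun k : {ffun 'I_n -> int} => colors k) xpredT
             (fun t => weight 'X m t * (G t)%:R)).
  rewrite -/(packed n m) -sum_permutations ?packed_uniq //.
  - by apply: eq_bigr => s _; rewrite FG polyC_natr.
  - exact: packed_perm.
  - exact: weight_perm.
rewrite /functional (bigD1 (Ordinal lt0N)) //= [X in _ + X]big1 ?addr0.
  by apply: eq_bigr => m _.
move=> n nn0; rewrite big1 // => m _; rewrite rowE big1 // => k _.
case Gk: (G (colors k)); last by rewrite mulr0.
by case/eqP: nn0; apply/val_inj; rewrite /= -(sG _ Gk) size_colors.
Qed.

Lemma functional_coefY N (P : sposet) : is_sposet P -> (projT1 P < N)%N ->
  functional N (fun s => (coefY (projT2 P) s)%:R) = 'X^(sinks (projT2 P)).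
Proof.
case: P => n E [/= ok acE] ltN; rewrite -sum_weight_preserves //.
rewrite (functional_count ltN _ (fun s => congr1 _ (coefYE E s))); last first.
  by move=> t /andP[/eqP].
apply: eq_bigr => m _; apply: eq_bigr => k _; rewrite size_colors eqxx /=.
by rewrite (@eq_preserves _ _ _ k) // => v; rewrite nth_colors.
Qed.

(** By linearity, phi depends on the series alone and not on the family; [N0] has to exceed every
    vertex count in [fam]. *)
Lemma functional_represents fam (F : seq int -> rat) :
    (forall x, List.In x fam -> is_sposet x.2) ->
    (forall s, \sum_(x <- fam) x.1 * (coefY (projT2 x.2) s)%:R = F s) ->
  exists N0, forall N, (N0 <= N)%N -> functional N F = phi_comb fam.
Proof.
elim: fam F => [|[c P] fam IH] F sP FE.
  exists 0%N => N _; rewrite /phi_comb big_nil /functional.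
  do 3![rewrite big1 // => ? _].
  by rewrite -FE big_nil mulr0.
have [|s|N0 IHN] := IH (fun s => F s - c * (coefY (projT2 P) s)%:R).
- by move=> x xf; apply: sP; right.
- by rewrite -FE big_cons addrC addKr.
exists (maxn N0 (projT1 P).+1) => N; rewrite geq_max => /andP[/IHN eN ltN].
rewrite /phi_comb big_cons -/(phi_comb fam) -eN /=.
rewrite -(functional_coefY (sP (c, P) (or_introl erefl)) ltN) /functional.
do 3![rewrite scaler_sumr -big_split; apply: eq_bigr => ? _ /=].
by rewrite -mul_polyC mulrCA -mulrDr -polyCM -polyCD addrC subrK.
Qed.

Lemma balancedP a b t : (0 < a)%N ->
  reflect (exists i : int, t = nseq a i ++ nseq b (- i)) (balanced a b t).
Proof.
move=> a_gt0; apply: (iffP eqP) => [->|[i ->]]; first by exists (head 0 t).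
by rewrite head_nseq_cat.
Qed.

(** A balanced tuple has a single absolute value, so only levels 0 and 1 survive. As a and b are
    positive, both tuples of level 1 contain -1 and the indicator in [weight] vanishes. *)
Lemma functional_balanced a b N (F : seq int -> rat) :
    (0 < a)%N -> (0 < b)%N -> (a + b < N)%N ->
    (forall s, F s = (coefP a b s)%:R) ->
  functional N F = (- (-1) ^+ (a + b))%:P.
Proof.
move=> a_gt0 b_gt0 ltN FE; pose bal (i : int) := nseq a i ++ nseq b (- i).
have sbal t : balanced a b t -> size t = (a + b)%N.
  by case/balancedP=> // i ->; rewrite size_cat !size_nseq.
have mbal i c : (c \in bal i) = (c == i) || (c == - i).
  by rewrite mem_cat !mem_nseq a_gt0 b_gt0.
rewrite (functional_count ltN sbal); last by move=> s; rewrite FE coefPE.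
pose S (m : nat) : {poly rat} := \sum_(k <- layers m [set: 'I_(a + b)])
    weight 'X m (colors k) * (balanced a b (colors k))%:R.
have SE m : S m = \sum_(t <- packed (a + b) m) weight 'X m t * (balanced a b t)%:R.
  by rewrite big_map.
have S0 : S 0 = (-1) ^+ (a + b).
  rewrite /S big_seq1 /weight size_colors /= mul0r subr0 addn0 mulr1.
  suff -> : balanced a b (colors ([ffun=> 0] : {ffun 'I_(a + b) -> int})) by rewrite mulr1.
  apply/balancedP=> //; exists 0; apply: (@eq_from_nth _ 0) => [|i].
    by rewrite size_colors size_cat !size_nseq.
  rewrite size_colors => lti; rewrite (nth_colors _ (Ordinal lti)) ffunE.
  by rewrite nth_cat !nth_nseq oppr0 !if_same.
have S1 : S 1 = - (-1) ^+ (a + b) *+ 2.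
  rewrite SE; under eq_bigr do rewrite mulr_natr mulrb.
  rewrite -big_mkcond -big_filter; set L := filter _ _.
  suff pb : perm_eq L [:: bal 1; bal (-1)].
    rewrite (perm_big _ pb) !big_cons big_nil /= addr0 /weight !mbal !size_cat !size_nseq.
    by rewrite !eqxx !orbT /= !mul0r subr0 mulr1 addn1 exprS mulN1r.
  apply: uniq_perm; rewrite ?filter_uniq ?packed_uniq //=.
    by rewrite inE andbT /bal; case: (a) a_gt0.
  move=> t; rewrite mem_filter !inE; apply/andP/orP.
    case=> /balancedP[] // i -> /mem_packed[_ le1 all1].
    have [//|z] := all1 1%N; rewrite -/(bal i) mbal => /orP zi z1.
    have [->|->] : i = 1 \/ i = -1 by case: zi => /eqP zi; lia.
      by left.
    by right.
  case=> /eqP->; (split; first by apply/balancedP => //; eexists);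
    apply/mem_packed; split=> [|c|c lec]; rewrite ?size_cat ?size_nseq ?mbal //.
  - by case/orP=> /eqP->.
  - by exists 1; [rewrite mbal eqxx | lia].
  - by case/orP=> /eqP->.
  by exists 1; [rewrite mbal opprK eqxx orbT | lia].
have S2 m : S m.+2 = 0.
  rewrite SE big_seq big1 // => t /mem_packed[_ _ tall].
  case: balancedP => //; rewrite ?mulr0 // => -[i ti].
  have [//|z zt z1] := tall 1%N; have [//|z' zt' z2] := tall 2%N.
  by move: zt zt'; rewrite ti -/(bal i) !mbal => /orP[]/eqP zi /orP[]/eqP zi'; lia.
rewrite -(big_mkord xpredT S).
have -> : (a + b).+1 = (a + b - 1).+2 by lia.
rewrite big_nat_recl // big_nat_recl // big1 ?addr0 => [|m _]; last exact: S2.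
rewrite S0 S1 polyCN rmorphXn rmorphN1 mulr2n.
by rewrite addrA subrr sub0r.
Qed.

End Functional.

(** * Signed stars and the expansion of p_{a,b} *)

Section Star.
Variables a b : nat.
Implicit Types (top : {ffun 'I_(a + b) -> option bool}) (j : 'I_(a + b)).

(** The bit [c] is the arrow at the center [ord0]; the sign forces the arrow at the leaf. The center
    counts among the equal colors, so these stars serve the exponent [a.+1]. *)
Definition star_edge j (c : bool) : sedge (a + b).+1 :=
  SEdge ord0 (lift ord0 j) (j < a)%N c (if (j < a)%N then ~~ c else c).

Definition star top := pmap (fun j => omap (star_edge j) (top j)) (enum 'I_(a + b)).

Lemma starP top e :
  reflect (exists j c, top j = Some c /\ e = star_edge j c) (e \in star top).
Proof.
rewrite mem_pmap; apply: (iffP mapP) => [[j _]|[j [c [tj ->]]]].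
  by case tj: (top j) => [c|] //= [->]; exists j, c.
by exists j; rewrite ?mem_enum // tj.
Qed.

Lemma star_orient_ok top : all (@orient_ok _) (star top).
Proof.
apply/allP=> e /starP[j [c [_ ->]]]; rewrite /orient_ok /=.
by case: (j < a)%N c => [] [].
Qed.

(* A leaf carries at most one arrow, and every edge ends at a leaf. *)
Lemma star_acyclic top : acyclic (star top).
Proof.
move=> [|d w] //; set W := d :: w => -[sE [jn io]].
have no_leaf j p : p \in W -> p.2 != lift ord0 j.
  move=> /In_mem pW; apply/eqP=> pj.
  have [[q /sE/In_mem/starP[j1 [c1 [t1 ->]]] q1] [r /sE/In_mem/starP[j2 [c2 [t2 ->]]] r2]] := io p pW.
  move: q1 r2; rewrite pj /toward /away /= !(inj_eq (lift_inj (h:=ord0))).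
  move=> /andP[/eqP e1 h1] /andP[/eqP e2 h2]; subst j1 j2.
  by move: t1 h1 h2; rewrite t2 => -[->] ->.
have dW : d \in W by rewrite inE eqxx.
have /starP[j [c [_ ed]]] : d.1 \in star top by apply/In_mem/sE/In_mem.
have := jn 0%N isT; rewrite /= ed /= => /orP[]/andP[/eqP h1 /eqP h2]; last first.
  by have := no_leaf j d dW; rewrite -h1 eqxx.
have := no_leaf j (nth d W (1 %% size W)); rewrite mem_nth ?ltn_mod //.
by move/(_ isT); rewrite -h2 eqxx.
Qed.

Lemma preserves_star top k : preserves (star top) k =
  [forall j, if top j is Some c then fits (star_edge j c) k else true].
Proof.
apply/allP/forallP=> [pr j|pr e /starP[j [c [tj ->]]]].
  case tj: (top j) => [c|] //; apply: pr; apply/starP.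
  by exists j, c.
by have := pr j; rewrite tj.
Qed.

(** A coloring proper at an edge fits exactly one of its two orientations, so 1 minus the sum over
    [c] indicates that the coloring is improper there. The choice [None] stands for the term 1, an
    omitted edge. *)
Lemma sum_star (k : 'I_(a + b).+1 -> int) :
  \sum_(top : {ffun 'I_(a + b) -> option bool}) (\prod_j (if top j is Some _ then -1 else 1)) * (preserves (star top) k)%:R
  = ([forall j : 'I_(a + b), k ord0 == sgnz (j < a)%N (k (lift ord0 j))])%:R :> rat.
Proof.
pose P j c := fits (star_edge j c) k.
transitivity (\prod_(j in [set: 'I_(a + b)]) (1 + \sum_(c : bool) (P j c)%:R * -1) : rat).
  rewrite -(sum_subset_tops _ _ (fun=> -1)); apply: eq_big => top; first by rewrite subsetT.
  by move=> _; rewrite preserves_star mulrC.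
have PE j : 1 + \sum_(c : bool) (P j c)%:R * -1
    = (k ord0 == sgnz (j < a)%N (k (lift ord0 j)))%:R :> rat.
  pose s := sgnz (j < a)%N (k (lift ord0 j)).
  have fE c : P j c = (k ord0 != s) && (c == (s < k ord0)).
    by rewrite /P /fits /s /sgnz /=; case: (j < a)%N; case: c; lia.
  rewrite big_bool !fE -/s; case: (k ord0 == s); case: (s < k ord0); by [].
rewrite (eq_bigr _ (fun j _ => PE j)).
by rewrite natr_forall; apply: eq_bigl => j; rewrite inE.
Qed.

End Star.

Lemma balanced_colors a b (k : 'I_(a + b).+1 -> int) :
  balanced a.+1 b (colors k) =
  [forall j : 'I_(a + b), k ord0 == sgnz (j < a)%N (k (lift ord0 j))].
Proof.
have hk : head 0 (colors k) = k ord0 by rewrite -nth0 (nth_colors k ord0).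
have nthE j : nth 0 (nseq a.+1 (k ord0) ++ nseq b (- k ord0)) (lift ord0 j : 'I_(a + b).+1)
    = if (j < a)%N then k ord0 else - k ord0.
  rewrite nth_cat size_nseq !nth_nseq lift0 ltnS; case: ltnP => // leaj.
  by rewrite subSS ltn_subLR // ltn_ord.
rewrite /balanced hk; apply/eqP/forallP=> [kE j|kE].
  have := nth_colors k (lift ord0 j); rewrite kE nthE => <-.
  by case: (j < a)%N; rewrite /sgnz ?opprK.
apply: (@eq_from_nth _ 0) => [|i].
  by rewrite size_colors size_cat !size_nseq.
rewrite size_colors => lti; rewrite (nth_colors k (Ordinal lti)).
rewrite -[i]/(nat_of_ord (Ordinal lti)); case: (unliftP ord0 (Ordinal lti)) => [j|] -> //.
rewrite nthE; have /eqP -> := kE j.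
by case: (j < a)%N; rewrite /sgnz ?opprK.
Qed.

Lemma exists_represents a b : (0 < a)%N ->
  exists fam : seq (rat * sposet), represents_p a b fam.
Proof.
case: a => // a _.
exists [seq (\prod_j (if top j is Some _ then -1 else 1),
             existT (fun n => seq (sedge n)) (a + b).+1 (star top)) |
         top : {ffun 'I_(a + b) -> option bool} <- enum {: {ffun 'I_(a + b) -> option bool}}].
split=> [x|s].
  elim: (enum _) => //= top tops IH [<-|//].
  by split; [exact: star_orient_ok | exact: star_acyclic].
rewrite big_map big_enum /= coefPE //.
under eq_bigr do rewrite coefYE natr_count mulr_sumr.
rewrite exchange_big natr_count; apply: eq_bigr => t _ /=.
(* Tuples of another length contribute 0 on both sides. *)
case: (size t =P (a + b).+1) => [st|st] /=; last first.
  rewrite big1 => [|top _]; last by rewrite mulr0.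
  by case: balancedP => // -[i ti]; case: st; rewrite ti size_cat !size_nseq.
rewrite -{2}(colors_nth st) balanced_colors.
exact: (sum_star (fun v => nth 0 t v)).
Qed.

Theorem theorem6p7 (a b : nat) (ha : (1 <= a)%N) (hb : (1 <= b)%N) :
  (exists fam : seq (rat * sposet), represents_p a b fam) /\
  (forall fam : seq (rat * sposet), represents_p a b fam ->
     phi_comb fam = (- (-1) ^+ (a + b))%:P).
Proof.
split; first exact: exists_represents.
move=> fam [famP famE].
have [N0 N0E] := functional_represents famP famE.
(* Large enough for the functional to agree with phi on [fam] and to see degree a + b. *)
pose N := maxn N0 (a + b).+1.
rewrite -(N0E N) ?leq_maxl //.
by apply: functional_balanced; rewrite ?leq_maxr.
Qed.
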